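(* Let $m\ge 27$ be an integer and let $p,l$ be positive integers with $p\le 27\sqrt{m}+\frac{16\sqrt{m}}{\log^{3} m}$ and $l\le 27\sqrt{m}$. Let $H$ be a graph such that $\Delta(H)\le \frac{16\sqrt{m}}{\log^{3} m}$ and $n(H)\le 2^{\frac{106\sqrt{m}}{\log m}}$, and such that there is a set $S\subseteq V(H)$ with $|S|\le \sqrt{m^{3}}-27\sqrt{m}$ and $\Delta(H-S)<\frac{\log m}{4}$. Let $G_1=K_p$ and $G_2=K_l+H$. Then $$R(G_1,G_2)\le 2^{250\sqrt{m}}.$$
   Context: Graphs are finite and simple. For graphs $G_1,G_2$, the Ramsey number $R(G_1,G_2)$ is the smallest positive integer $N$ such that every blue-red edge coloring of the complete graph $K_N$ contains a blue subgraph isomorphic to $G_1$ or a red subgraph isomorphic to $G_2$. The join $G+H$ of two graphs $G$ and $H$ (on disjoint vertex sets) is the graph with vertex set $V(G)\cup V(H)$ and edge set $E(G)\cup E(H)\cup\{uv : u\in V(G), v\in V(H)\}$. $K_r$ is the complete graph on $r$ vertices, $n(H)$ is the number of vertices of $H$, $\Delta(\cdot)$ denotes maximum degree, and $H-S$ is the graph obtained from $H$ by deleting the vertices in $S$. $\log$ denotes the logarithm in base $2$, and $\log^3 m=(\log m)^3$. *)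

(* Defs.v *)
From mathcomp Require Import all_boot all_order all_algebra.
From mathcomp Require Import boolp reals exp.
Set Implicit Arguments.
Unset Strict Implicit.
Unset Printing Implicit Defensive.

Record sgraph := SGraph {
  vertex :> finType;
  edge : rel vertex;
  edge_sym : symmetric edge;
  edge_irr : irreflexive edge
}.

Lemma neq_sym (T : eqType) : symmetric (fun x y : T => x != y).
Proof. by move=> x y; rewrite eq_sym. Qed.

Lemma neq_irr (T : eqType) : irreflexive (fun x y : T => x != y).
Proof. by move=> x; rewrite eqxx. Qed.

Definition complete (r : nat) : sgraph :=
  SGraph (@neq_sym 'I_r) (@neq_irr 'I_r).

Definition join_edge (G H : sgraph) : rel (G + H)%type := fun u v =>
  match u, v with
  | inl x, inl y => edge x y
  | inr x, inr y => edge x y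
  | _, _ => true
  end.

Lemma join_sym (G H : sgraph) : symmetric (@join_edge G H).
Proof. by case=> x [] y //=; rewrite edge_sym. Qed.

Lemma join_irr (G H : sgraph) : irreflexive (@join_edge G H).
Proof. by case=> x //=; rewrite edge_irr. Qed.

Definition join (G H : sgraph) : sgraph :=
  SGraph (@join_sym G H) (@join_irr G H).

Section Delete.
Variables (H : sgraph) (S : {set H}).

Definition delete_edge : rel {x : H | x \notin S} :=
  fun u v => edge (val u) (val v).

Lemma delete_sym : symmetric delete_edge.
Proof. by move=> u v; rewrite /delete_edge edge_sym. Qed.

Lemma delete_irr : irreflexive delete_edge.
Proof. by move=> u; rewrite /delete_edge edge_irr. Qed.

Definition delete : sgraph := SGraph delete_sym delete_irr.
End Delete.

(* The graph with no vertex gets maximum degree 0. *)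
Definition max_degree (G : sgraph) : nat :=
  \max_(x : G) #|[set y : G | edge x y]|.

(* Subgraphs need not be induced: only edges of G are constrained. *)
Definition has_copy (G : sgraph) (T : Type) (e : rel T) : Prop :=
  exists2 f : G -> T, injective f & forall x y, edge x y -> e (f x) (f y).

(* A blue-red colouring of the edges of K_N is a symmetric relation on 'I_N
   (true is blue, false is red); since copies are injective, its values on the
   diagonal play no role. *)
Definition arrows (N : nat) (G1 G2 : sgraph) : Prop :=
  forall c : rel 'I_N, symmetric c ->
    has_copy G1 c \/ has_copy G2 (fun x y => ~~ c x y).

Definition clique (T : finType) (e : rel T) (K : {set T}) : Prop :=
  {in K &, forall x y, x != y -> e x y}.

Lemma clique_copy (G : sgraph) (T : finType) (e : rel T) (K : {set T}) :
  #|G| <= #|K| -> clique e K -> has_copy G e.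
Proof.
move=> le_GK clK.
pose f x := enum_val (widen_ord le_GK (enum_rank x)).
have f_inj : injective f.
  by move=> x y /enum_val_inj/(congr1 val)/= /val_inj/enum_rank_inj.
exists f => // x y exy; apply: clK; try exact: enum_valP.
by rewrite inj_eq //; apply: contraTneq exy => ->; rewrite edge_irr.
Qed.

Lemma clique_add (T : finType) (e : rel T) (x : T) (A K : {set T}) :
    symmetric e -> K \subset [set y in A :\ x | e x y] -> clique e K ->
  #|x |: K| = #|K|.+1 /\ clique e (x |: K).
Proof.
move=> e_sym /subsetP sKA clK.
have xK y : y \in K -> (y != x) && e x y.
  by move/sKA; rewrite !inE => /andP[/andP[-> _] ->].
split.
  by rewrite cardsU1; case: (boolP (x \in K)) => // /xK; rewrite eqxx.
move=> y z; rewrite !inE => /orP[/eqP-> | Ky] /orP[/eqP-> | Kz].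
- by rewrite eqxx.
- by move=> _; case/andP: (xK z Kz).
- by move=> _; rewrite e_sym; case/andP: (xK y Ky).
- exact: clK.
Qed.

Lemma ramsey_cliques (s t : nat) : exists N, forall (T : finType) (c : rel T)
    (A : {set T}), symmetric c -> N <= #|A| ->
  (exists2 K : {set T}, K \subset A & s <= #|K| /\ clique c K) \/
  (exists2 K : {set T}, K \subset A &
     t <= #|K| /\ clique (fun x y => ~~ c x y) K).
Proof.
have clique0 (T : finType) (e : rel T) : clique e set0.
  by move=> x y; rewrite inE.
elim: s t => [|s IHs] t.
  by exists 0 => T c A _ _; left; exists set0; rewrite ?sub0set.
elim: t => [|t [b IHt]].
  by exists 0 => T c A _ _; right; exists set0; rewrite ?sub0set.
have [a {}IHs] := IHs t.+1.
exists (a + b).+1 => T c A c_sym le_abA.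
have /card_gt0P[x Ax] : 0 < #|A| by apply: leq_trans le_abA.
pose B := [set y in A :\ x | c x y]; pose C := [set y in A :\ x | ~~ c x y].
have cardBC : #|B| + #|C| = #|A|.-1.
  rewrite (cardsD1 x A) Ax add1n /= -(cardsID [set y | c x y] (A :\ x)).
  congr (_ + _); apply: eq_card => y; rewrite !inE //.
  by rewrite andbC.
have sBA : B \subset A by apply/subsetP=> y; rewrite !inE => /andP[/andP[]].
have sCA : C \subset A by apply/subsetP=> y; rewrite !inE => /andP[/andP[]].
have sxA (K : {set T}) : K \subset A -> x |: K \subset A.
  by move=> sKA; rewrite subUset sub1set Ax.
have nc_sym : symmetric (fun y z => ~~ c y z) by move=> y z; rewrite c_sym.
have [le_aB | lt_Ba] := leqP a #|B|.
  have [[K sKB [sK clK]]|[K sKB HK]] := IHs T c B c_sym le_aB.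
    have [cardK clxK] := clique_add c_sym sKB clK.
    left; exists (x |: K); first exact/sxA/(subset_trans sKB).
    by rewrite cardK.
  by right; exists K => //; apply: subset_trans sBA.
have le_bC : b <= #|C|.
  rewrite -(leq_add2l #|B|) cardBC -ltnS prednK; last by apply/card_gt0P; exists x.
  by apply: leq_trans le_abA; rewrite ltnS leq_add2r ltnW.
have [[K sKC HK]|[K sKC [tK clK]]] := IHt T c C c_sym le_bC.
  by left; exists K => //; apply: subset_trans sCA.
have [cardK clxK] := clique_add nc_sym sKC clK.
right; exists (x |: K); first exact/sxA/(subset_trans sKC).
by rewrite cardK.
Qed.

Lemma ramsey_exists (G1 G2 : sgraph) :
  exists N, (0 < N) && `[< arrows N G1 G2 >].
Proof.
have [N HN] := ramsey_cliques #|G1| #|G2|.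
exists N.+1 => /=; apply/asboolP => c c_sym.
have [] := HN _ c [set: 'I_N.+1] c_sym; first by rewrite cardsT card_ord.
  by case=> K _ [? ?]; left; apply: (@clique_copy _ _ _ K).
by case=> K _ [? ?]; right; apply: (@clique_copy _ _ _ K).
Qed.

Definition ramsey (G1 G2 : sgraph) : nat := ex_minn (ramsey_exists G1 G2).

Definition log2 (R : realType) (x : R) : R := (ln x / ln 2)%R.

(* Main.v *)
Require Import Defs.
From mathcomp Require Import all_boot all_order all_algebra.
From mathcomp Require Import boolp reals exp.
From mathcomp Require Import zify ring lra.
Import Order.TTheory GRing.Theory Num.Theory.
Set Implicit Arguments.
Unset Strict Implicit.

(** The theorem follows from the bound
    R(K_p, K_l + H) <= 2^(p+l) * max(1, n) * (8p)^(D h), valid for every graph H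
    with n vertices and maximum degree D as soon as 1 <= p <= 2^h
    ([ramsey_join_le]); with h about log p, D of order s / L^3 and
    n <= 2^(106 s / L), where s = sqrt m and L = log m, the exponent of 2 is at
    most about 101 s.

    The factor 2^(p+l) is the Erdos-Szekeres argument ([clique_or_red_join]):
    moving repeatedly to the more frequent colour at a vertex costs a factor of
    2 per step and stops with a blue K_p, or with a red K_l whose common red
    neighbourhood is still large.  In that neighbourhood it remains to find a
    blue K_p or a red H ([clique_or_bounded_degree]), which is done by an
    argument in the style of Erdos and Hajnal.  Suppose that there is neither.
    If every two large sets X, Y had a vertex of X with red degree at least
    |Y| / (2p) into Y, then H could be embedded in red greedily, keeping for
    each vertex that is not yet embedded a set of candidates which shrinks at
    most D times by a factor 2p ([greedy_embedding]).  So some large X and Y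
    have sparse red density in the strong sense that each vertex of X has fewer
    than |Y| / (2p) red neighbours in Y.  A blue clique in X has fewer than p
    vertices, so at least half of Y is completely blue to it, and a blue clique
    of the same size in that half doubles it ([clique_doubling]).  After h
    doublings the clique has 2^h >= p vertices, and each doubling cost a factor
    of at most (8p)^D. *)

(** * Copies inside a set *)

Definition copy_in (G : sgraph) (T : finType) (e : rel T) (A : {set T}) : Prop :=
  exists f : G -> T,
    [/\ injective f, forall x, f x \in A & forall x y, edge x y -> e (f x) (f y)].

Definition neighbours (T : finType) (e : rel T) (x : T) : {set T} := [set y | e x y].

Lemma card_neighbours (G : sgraph) (x : G) :
  #|neighbours (@edge G) x| <= max_degree G.
Proof. exact: (leq_bigmax (F := fun x : G => #|[set y : G | edge x y]|)). Qed.

Lemma card_bigcup_leq (I T : finType) (P : pred I) (F : I -> {set T}) :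
  #|\bigcup_(i | P i) F i| <= \sum_(i | P i) #|F i|.
Proof.
elim/big_ind2: _ => [|m A n B le_A le_B|] //; first by rewrite cards0.
by apply: (leq_trans (leq_card_setU A B)); rewrite leq_add.
Qed.

(** * Greedy embedding of a graph of bounded degree *)

(** The vertices of G are embedded one at a time.  An unembedded vertex w keeps
    as candidates the vertices of A adjacent to the images of all embedded
    neighbours of w; this set loses a factor of at most k per embedded
    neighbour, so it never has fewer than |G| + D M elements.  The next vertex v
    can then avoid the fewer than |G| images already used and, for each of its
    at most D unembedded neighbours w, the at most M candidates that are
    adjacent to less than a fraction 1/k of the candidates for w. *)
Lemma greedy_embedding (G : sgraph) (T : finType) (r : rel T) (A : {set T})
    (k D M : nat) :
  symmetric r -> 0 < k -> max_degree G <= D ->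
  k ^ D * (#|G| + D * M) <= #|A| ->
  (forall X Y : {set T}, X \subset A -> Y \subset A -> M <= #|X| -> M <= #|Y| ->
     exists2 x, x \in X & #|Y| <= k * #|Y :&: neighbours r x|) ->
  copy_in G r A.
Proof.
move=> r_sym k_gt0 degD cardA dense.
pose cand (W : {set G}) (f : G -> T) w :=
  [set a in A | [forall u in W, edge w u ==> r (f u) a]].
suff partial j : j <= #|G| -> exists (W : {set G}) (f : G -> T),
    [/\ #|W| = j, {in W &, injective f}, {in W, forall u, f u \in A},
        {in W &, forall u v, edge u v -> r (f u) (f v)} &
        forall w, w \notin W ->
          #|A| <= k ^ #|neighbours (@edge G) w :&: W| * #|cand W f w|].
  have [W [f [cardW f_inj fA f_edge _]]] := partial _ (leqnn _).
  have WT x : x \in W.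
    suff -> : W = [set: G] by rewrite inE.
    by apply/eqP; rewrite eqEcard subsetT cardsT cardW leqnn.
  exists f; split=> [x y|x|x y]; [exact: f_inj | exact: fA | exact: f_edge].
elim: j => [_|j IHj lt_jG].
  have [f0 _] : exists f : G -> T, True.
    have [/card0_eq G0|G_gt0] := posnP #|G|.
      have no_vertex (x : G) : False by have := G0 x; rewrite inE.
      by exists (fun x => False_rect T (no_vertex x)).
    suff /card_gt0P[a _] : 0 < #|A| by exists (fun=> a).
    by apply: (leq_trans _ cardA); rewrite muln_gt0 expn_gt0 k_gt0 addn_gt0 G_gt0.
  exists set0, f0; split=> [|x y|x|x y|w _]; rewrite ?cards0 ?inE //.
  rewrite setI0 cards0 mul1n subset_leq_card //; apply/subsetP=> a Aa.
  by rewrite inE Aa; apply/forallP=> u; rewrite inE.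
have [W [f [cardW f_inj fA f_edge f_cand]]] := IHj (ltnW lt_jG).
have cand_large w : w \notin W -> #|G| + D * M <= #|cand W f w|.
  move=> /f_cand le_A; rewrite -(@leq_pmul2l (k ^ D)) ?expn_gt0 ?k_gt0 //.
  apply: leq_trans (leq_trans cardA le_A) _; rewrite leq_mul2r; apply/orP; right.
  apply: leq_pexp2l => //.
  apply: (leq_trans _ degD); apply: (leq_trans _ (card_neighbours w)).
  by rewrite subset_leq_card ?subsetIl.
have candA w : cand W f w \subset A by apply/subsetP=> a; rewrite inE => /andP[].
have [v vW] : exists v, v \notin W.
  apply/existsP; rewrite -negb_forall; apply: contraTN lt_jG => /forallP WT.
  by rewrite -cardW -leqNgt -cardsT subset_leq_card //; apply/subsetP.
(* The images of v that would shrink the candidates for w too much. *)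
pose bad w := [set x in cand W f v |
  k * #|cand W f w :&: neighbours r x| < #|cand W f w|].
have card_bad w : w \notin W -> edge v w -> #|bad w| <= M.
  move=> wW vw; rewrite leqNgt; apply/negP => lt_M.
  have D_gt0 : 0 < D.
    apply: (leq_trans _ degD); apply: (leq_trans _ (card_neighbours v)).
    by apply/card_gt0P; exists w; rewrite inE.
  have bad_cand : bad w \subset cand W f v.
    by apply/subsetP=> x; rewrite inE => /andP[].
  have [||x xbad] := dense (bad w) (cand W f w) _ (candA w) (ltnW lt_M).
  - exact: subset_trans bad_cand (candA v).
  - apply: (leq_trans _ (cand_large w wW)); apply: (leq_trans _ (leq_addl _ _)).
    by rewrite leq_pmull.
  by rewrite leqNgt; move: xbad; rewrite inE => /andP[_ ->].
pose forbidden := f @: W :|: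
  \bigcup_(w in neighbours (@edge G) v :\: W) bad w.
have [x xcand xgood] : exists2 x, x \in cand W f v & x \notin forbidden.
  apply/subsetPn; apply: contraTN (cand_large v vW) => /subset_leq_card le_cand.
  rewrite -ltnNge; apply: leq_ltn_trans le_cand _.
  apply: leq_ltn_trans (leq_card_setU _ _) _; rewrite -addSn leq_add //.
    by apply: leq_ltn_trans (leq_imset_card _ _) _; rewrite cardW.
  apply: leq_trans (_ : \sum_(w in neighbours (@edge G) v :\: W) M <= _).
    apply: leq_trans (card_bigcup_leq _ _) _.
    by apply: leq_sum => w; rewrite !inE => /andP[wW vw]; apply: card_bad.
  rewrite sum_nat_const leq_mul2r; apply/orP; right.
  apply: (leq_trans _ degD); apply: (leq_trans _ (card_neighbours v)).
  by rewrite subset_leq_card ?subsetDl.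
have x_new u : u \in W -> f u != x.
  move=> uW; apply: contraNneq xgood => <-.
  by rewrite inE imset_f.
have x_edge u : u \in W -> edge v u -> r (f u) x.
  by move=> uW; apply/implyP; move: xcand; rewrite inE => /andP[_ /forall_inP]; apply.
pose f' u := if u == v then x else f u.
have f'W u : u \in W -> f' u = f u.
  by rewrite /f'; case: eqP => // -> /(negP vW).
have f'v : f' v = x by rewrite /f' eqxx.
exists (v |: W), f'; split.
- by rewrite cardsU1 vW cardW.
- move=> y z; rewrite !inE => /orP[/eqP->|yW] /orP[/eqP->|zW] //.
  + by rewrite f'v f'W // => /esym/eqP; rewrite (negPf (x_new _ _)).
  + by rewrite f'v f'W // => /eqP; rewrite (negPf (x_new _ _)).
  + by rewrite !f'W //; apply: f_inj.
- move=> y; rewrite !inE => /orP[/eqP->|yW]; last by rewrite f'W ?fA.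
  by rewrite f'v (subsetP (candA v)).
- move=> y z; rewrite !inE => /orP[/eqP->|yW] /orP[/eqP->|zW].
  + by rewrite edge_irr.
  + by rewrite f'v f'W // r_sym; apply: x_edge.
  + by rewrite f'v f'W // edge_sym; apply: x_edge.
  + by rewrite !f'W //; apply: f_edge.
move=> w; rewrite !inE negb_or => /andP[wv wW].
have cand' : cand (v |: W) f' w =
    if edge w v then cand W f w :&: neighbours r x else cand W f w.
  apply/setP=> a; case: ifP => wv_edge; rewrite !inE -?andbA; congr (_ && _).
    apply/forall_inP/andP => [ra|[/forall_inP ra rxa] u].
      split; last by have := ra v; rewrite !inE eqxx wv_edge f'v; apply.
      by apply/forall_inP=> u uW; have := ra u; rewrite !inE uW orbT f'W //; apply.
    by rewrite !inE => /orP[/eqP->|uW]; rewrite ?f'v ?rxa ?implybT ?f'W ?ra.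
  apply/forall_inP/forall_inP => ra u.
    by move=> uW; have := ra u; rewrite !inE uW orbT f'W //; apply.
  by rewrite !inE => /orP[/eqP->|uW]; [rewrite wv_edge | rewrite f'W ?ra].
have nbr' : #|neighbours (@edge G) w :&: (v |: W)| =
    edge w v + #|neighbours (@edge G) w :&: W|.
  rewrite setIUr; have [wv_edge|wv_edge] := boolP (edge w v).
    rewrite (setIidPr _) ?sub1set ?inE // cardsU1.
    by rewrite !inE (negPf vW) andbF.
  suff -> : neighbours (@edge G) w :&: [set v] = set0 by rewrite set0U.
  by apply/setP=> u; rewrite !inE; case: eqP => [->|]; rewrite ?(negPf wv_edge) ?andbF.
rewrite cand' nbr'; case: ifP => wv_edge; last exact: f_cand.
apply: leq_trans (f_cand w wW) _; rewrite expnS (mulnC k) -mulnA leq_mul2l.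
rewrite leqNgt; apply/orP; right; apply: contraNN xgood => x_bad.
rewrite inE; apply/orP; right; apply/bigcupP; exists w.
  by rewrite !inE wW edge_sym.
by rewrite inE xcand.
Qed.

Lemma copy_in_sub (G : sgraph) (T : finType) (e : rel T) (A B : {set T}) :
  A \subset B -> copy_in G e A -> copy_in G e B.
Proof.
by move=> /subsetP sAB [f [f_inj fA fe]]; exists f; split=> // x; apply: sAB.
Qed.

(** * Blue cliques from sparse red pairs *)

(** The size that forces a blue clique on 2^h vertices.  One doubling needs
    (2p)^D (n + 2 D M) vertices when M is the size needed for the two halves;
    as 1 + 2D <= 4^D, this is at most (8p)^D M once n <= M, and the maximum with
    1 makes M positive also when the graph is empty. *)
Definition bounded_degree_ramsey (n D p h : nat) := maxn 1 n * (8 * p) ^ (D * h).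

(** If the greedy embedding fails, there are X and Y with few red edges from
    every vertex of X to Y.  The cliques on 2^h vertices in X and in the part of
    Y that is blue to the first one are joined.  That no clique reaches p
    vertices is what keeps at least half of Y in that part. *)
Lemma clique_doubling (G : sgraph) (T : finType) (c : rel T) (p h : nat)
    (A : {set T}) :
  symmetric c -> irreflexive c -> (forall K, clique c K -> #|K| < p) ->
  bounded_degree_ramsey #|G| (max_degree G) p h <= #|A| ->
  copy_in G (fun x y => ~~ c x y) A \/
  (exists2 K : {set T}, K \subset A & clique c K /\ 2 ^ h <= #|K|).
Proof.
move=> c_sym c_irr no_clique.
pose r x y := ~~ c x y; pose D := max_degree G.
have p_gt0 : 0 < p by apply: leq_ltn_trans (no_clique set0 _) => // x y; rewrite inE.
elim: h A => [|h IHh] A.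
  rewrite /bounded_degree_ramsey muln0 muln1 => /(leq_trans (leq_maxl _ _)).
  move=> /card_gt0P[a Aa]; right; exists [set a]; rewrite ?sub1set ?cards1 //.
  by split=> // x y; rewrite !inE => /eqP-> /eqP->; rewrite eqxx.
set M := bounded_degree_ramsey _ _ p h in IHh.
have M_ge : maxn 1 #|G| <= M.
  by rewrite /M leq_pmulr // expn_gt0 muln_gt0 p_gt0.
move=> cardA.
have [|dense] := boolP [exists X : {set T}, exists Y : {set T},
  [&& X \subset A, Y \subset A, 2 * M <= #|X|, 2 * M <= #|Y| &
      [forall x in X, 2 * p * #|Y :&: neighbours r x| < #|Y|]]]; last first.
  left; apply: (@greedy_embedding _ _ _ _ (2 * p) D (2 * M)) => //.
  - by move=> x y; rewrite c_sym.
  - by rewrite muln_gt0.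
  - apply: leq_trans cardA.
    have -> : bounded_degree_ramsey #|G| D p h.+1 = (2 * p) ^ D * (4 ^ D * M).
      rewrite mulnA -expnMn (_ : 2 * p * 4 = 8 * p); last lia.
      by rewrite mulnCA -expnD -mulnS.
    rewrite leq_mul2l.
    apply/orP; right; apply: (@leq_trans ((1 + D * 2) * M)).
      by rewrite mulnDl mul1n -mulnA leq_add2r (leq_trans (leq_maxr _ _) M_ge).
    rewrite leq_mul2r; apply/orP; right.
    by elim: (D) => // d; rewrite expnS; lia.
  move=> X Y sXA sYA leX leY; apply/exists_inP; move: dense.
  rewrite negb_exists => /forallP/(_ X); rewrite negb_exists => /forallP/(_ Y).
  rewrite sXA sYA leX leY /= negb_forall => /existsP[x].
  by rewrite negb_imply -leqNgt => ?; apply/existsP; exists x.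
move=> /existsP[X /existsP[Y /and5P[sXA sYA leX leY /forall_inP sparse]]].
have [|copyX|[K1 sK1 [clK1 cardK1]]] := IHh X.
- by apply: leq_trans leX; rewrite leq_pmull.
- by left; apply: copy_in_sub sXA copyX.
(* The vertices of Y joined in blue to all of K1; the diagonal of c being red,
   they lie outside K1. *)
pose Y' := Y :\: \bigcup_(x in K1) neighbours r x.
have sY'A : Y' \subset A by apply: subset_trans (subsetDl _ _) sYA.
have leY' : M <= #|Y'|.
  have : #|Y :&: \bigcup_(x in K1) neighbours r x|
         <= \sum_(x in K1) #|Y :&: neighbours r x|.
    by rewrite big_distrr card_bigcup_leq.
  have : 2 * p * \sum_(x in K1) #|Y :&: neighbours r x| <= p * #|Y|.
    apply: (@leq_trans (\sum_(x in K1) #|Y|)).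
      rewrite big_distrr leq_sum // => x K1x.
      by rewrite ltnW // sparse // (subsetP sK1).
    by rewrite sum_nat_const leq_mul2r ltnW ?no_clique ?orbT.
  rewrite (mulnC 2) -mulnA leq_pmul2l //.
  by move: leY; rewrite -(cardsID (\bigcup_(x in K1) neighbours r x) Y) -/Y'; lia.
have [|copyY|[K2 sK2 [clK2 cardK2]]] := IHh Y'.
- exact: leY'.
- by left; apply: copy_in_sub sY'A copyY.
have cross x y : x \in K1 -> y \in K2 -> c x y.
  move=> K1x /(subsetP sK2); rewrite inE => /andP[yr _].
  by apply: contraNT yr => xy; apply/bigcupP; exists x; rewrite ?inE.
right; exists (K1 :|: K2).
  by rewrite subUset (subset_trans sK1 sXA) (subset_trans sK2 sY'A).
split.
  move=> x y; rewrite !inE => /orP[x1|x2] /orP[y1|y2] xy.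
  - exact: clK1.
  - exact: cross.
  - by rewrite c_sym cross.
  - exact: clK2.
rewrite cardsU (_ : K1 :&: K2 = set0) ?cards0 ?subn0; last first.
  apply/setP=> x; rewrite !inE; apply/negP => /andP[x1 x2].
  by have := cross x x x1 x2; rewrite c_irr.
by rewrite expnS mul2n -addnn leq_add.
Qed.

Lemma clique_or_bounded_degree (G : sgraph) (T : finType) (c : rel T) (p h : nat)
    (A : {set T}) :
  symmetric c -> irreflexive c -> p <= 2 ^ h ->
  bounded_degree_ramsey #|G| (max_degree G) p h <= #|A| ->
  (exists2 K : {set T}, clique c K & p <= #|K|) \/
  copy_in G (fun x y => ~~ c x y) A.
Proof.
move=> c_sym c_irr le_ph cardA.
have [no_clique|[K clK pK]] :
    (forall K, clique c K -> #|K| < p) \/ (exists2 K, clique c K & p <= #|K|).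
- apply: contrapT => /not_orP[/existsNP[K /not_implyP[clK /negP]]].
  by rewrite -leqNgt => pK []; exists K.
- have [|[K _ [clK hK]]] := clique_doubling c_sym c_irr no_clique cardA; first by right.
  by left; exists K; rewrite ?(leq_trans le_ph).
by left; exists K.
Qed.

(** * The Erdos-Szekeres step and the Ramsey bound *)

(** The Erdos-Szekeres induction, stopped while M vertices are left: besides a
    red clique on l vertices it provides a set B, red to the clique, in which H
    is to be embedded. *)
Lemma clique_or_red_join (T : finType) (c : rel T) (M p l : nat) (A : {set T}) :
  symmetric c -> irreflexive c -> 0 < M -> 2 ^ (p + l) * M <= #|A| ->
  (exists2 K : {set T}, K \subset A & clique c K /\ #|K| = p) \/
  (exists K B : {set T}, [/\ K \subset A, B \subset A, M <= #|B|,
     clique (fun x y => ~~ c x y) K /\ #|K| = l &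
     {in K & B, forall x y, x != y /\ ~~ c x y}]).
Proof.
move=> c_sym c_irr M_gt0.
have clique0 (e : rel T) : clique e set0 by move=> x y; rewrite inE.
move Es: (p + l) => s; elim: s p l A Es => [|s IHs] p l A.
  move=> /eqP; rewrite addn_eq0 => /andP[/eqP-> _] _.
  by left; exists set0; rewrite ?sub0set ?cards0.
case: p => [_ _|p]; first by left; exists set0; rewrite ?sub0set ?cards0.
case: l => [_ cardA|l pl cardA].
  right; exists set0, A; split; rewrite ?sub0set ?cards0 //.
    by apply: leq_trans cardA; rewrite leq_pmull ?expn_gt0.
  by move=> x y; rewrite inE.
have /card_gt0P[x Ax] : 0 < #|A|.
  by apply: leq_trans cardA; rewrite muln_gt0 expn_gt0.
pose Bl := [set y in A :\ x | c x y]; pose Rd := [set y in A :\ x | ~~ c x y].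
have cardBR : #|Bl| + #|Rd| = #|A|.-1.
  rewrite (cardsD1 x A) Ax add1n /= -(cardsID [set y | c x y] (A :\ x)).
  by congr (_ + _); apply: eq_card => y; rewrite !inE // andbC.
have sBA : Bl \subset A by apply/subsetP=> y; rewrite !inE => /andP[/andP[]].
have sRA : Rd \subset A by apply/subsetP=> y; rewrite !inE => /andP[/andP[]].
have nc_sym : symmetric (fun y z => ~~ c y z) by move=> y z; rewrite c_sym.
have [leB|leR] : 2 ^ s * M <= #|Bl| \/ 2 ^ s * M <= #|Rd|.
  by move: cardA; rewrite expnS; lia.
- have [|[K sKB [clK cardK]]|[K [B [sKB sBB leM [clK cardK] KB]]]] := IHs p l.+1 Bl _ leB.
  + lia.
  + have [cardxK clxK] := clique_add c_sym sKB clK.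
    left; exists (x |: K); last by rewrite cardxK cardK.
    by rewrite subUset sub1set Ax (subset_trans sKB sBA).
  + by right; exists K, B; split=> //; [exact: subset_trans sBA | exact: subset_trans sBA].
have [|[K sKB [clK cardK]]|[K [B [sKR sBR leM [clK cardK] KB]]]] := IHs p.+1 l Rd _ leR.
- lia.
- by left; exists K => //; apply: subset_trans sRA.
have [cardxK clxK] := clique_add nc_sym sKR clK.
right; exists (x |: K), B; split; rewrite ?cardxK ?cardK //.
- by rewrite subUset sub1set Ax (subset_trans sKR sRA).
- exact: subset_trans sRA.
move=> y z; rewrite !inE => /orP[/eqP->|yK] zB; last exact: KB.
by move: (subsetP sBR z zB); rewrite !inE eq_sym => /andP[/andP[-> _] ->].
Qed.

Lemma copy_neq (G : sgraph) (T : finType) (c : rel T) :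
  has_copy G (fun x y => ~~ ((x != y) && c x y)) -> has_copy G (fun x y => ~~ c x y).
Proof.
case=> f f_inj f_edge; exists f => // x y xy; have := f_edge x y xy.
by rewrite inj_eq //; case: eqP xy => // ->; rewrite edge_irr.
Qed.

Lemma has_copy_join (T : finType) (e : rel T) (l : nat) (H : sgraph) (K B : {set T}) :
  symmetric e -> clique e K -> #|K| = l ->
  {in K & B, forall x y, x != y /\ e x y} -> copy_in H e B ->
  has_copy (join (complete l) H) e.
Proof.
move=> e_sym clK cardK KB [f [f_inj fB f_edge]].
pose k (i : 'I_l) := enum_val (cast_ord (esym cardK) i).
have kK i : k i \in K by apply: enum_valP.
have k_inj : injective k by move=> i j /enum_val_inj/cast_ord_inj.
have kf i x : k i != f x by have [] := KB _ _ (kK i) (fB x).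
pose g (u : join (complete l) H) := match u with inl i => k i | inr x => f x end.
exists g.
  move=> [i|x] [j|y] //=; first by move/k_inj->.
  - by move/eqP; rewrite (negPf (kf _ _)).
  - by move/esym/eqP; rewrite (negPf (kf _ _)).
  - by move/f_inj->.
move=> [i|x] [j|y] /=.
- by move=> ij; apply: clK; rewrite ?inj_eq.
- by move=> _; have [] := KB _ _ (kK i) (fB y).
- by move=> _; rewrite e_sym; have [] := KB _ _ (kK j) (fB x).
- exact: f_edge.
Qed.

Lemma ramsey_join_le (H : sgraph) (p l h : nat) :
  0 < p -> p <= 2 ^ h ->
  ramsey (complete p) (join (complete l) H)
    <= 2 ^ (p + l) * bounded_degree_ramsey #|H| (max_degree H) p h.
Proof.
move=> p_gt0 le_ph; set M := bounded_degree_ramsey _ _ _ _.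
have M_gt0 : 0 < M.
  by rewrite /M muln_gt0 leq_max expn_gt0 muln_gt0 p_gt0.
rewrite /ramsey; case: ex_minnP => N _; apply.
rewrite muln_gt0 expn_gt0 M_gt0; apply/asboolP => c c_sym.
(* The lemmas above want an irreflexive blue relation; copies are injective, so
   making the diagonal red does not change which copies exist. *)
pose b x y := (x != y) && c x y.
have b_sym : symmetric b by move=> x y; rewrite /b eq_sym c_sym.
have nb_sym : symmetric (fun x y => ~~ b x y) by move=> x y; rewrite b_sym.
have b_irr : irreflexive b by move=> x; rewrite /b eqxx.
have blue K : clique b K -> p <= #|K| -> has_copy (complete p) c.
  move=> clK pK; apply: (@clique_copy _ _ _ K); first by rewrite card_ord.
  by move=> x y xK yK xy; have /andP[] := clK x y xK yK xy.
have [|[K _ [clK cardK]]|[K [B [_ _ leM [clK cardK] KB]]]] :=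
    @clique_or_red_join _ b M p l setT b_sym b_irr M_gt0.
- by rewrite cardsT card_ord.
- by left; apply: blue clK _; rewrite cardK.
have [[K' clK' pK']|copyH] := clique_or_bounded_degree b_sym b_irr le_ph leM.
  by left; apply: blue clK' pK'.
by right; apply: copy_neq; apply: has_copy_join nb_sym clK cardK KB copyH.
Qed.

Local Open Scope ring_scope.

(** * Powers of two with real exponents *)

Lemma powR2_log2 (R : realType) (x : R) : 0 < x -> 2 `^ log2 x = x.
Proof.
move=> x_gt0; have ln2_neq0 : ln (2 : R) != 0 by rewrite gt_eqF ?ln_gt0 ?ltr1n.
by rewrite /log2 /powR pnatr_eq0 /= divfK // lnK.
Qed.

Lemma powR2_half_log2 (R : realType) (x : R) : 0 < x -> 2 `^ (log2 x / 2) = Num.sqrt x.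
Proof. by move=> x_gt0; rewrite powRrM powR2_log2 // powR12_sqrt // ltW. Qed.

Lemma ler_powR2 (R : realType) (x y : R) : (2 `^ x <= 2 `^ y) = (x <= y).
Proof.
have ln2_gt0 : 0 < ln (2 : R) by rewrite ln_gt0 ?ltr1n.
by rewrite /powR pnatr_eq0 /= ler_expR ler_pM2r.
Qed.

Lemma powR2D (R : realType) (x y : R) : 2 `^ (x + y) = 2 `^ x * 2 `^ y.
Proof. by rewrite powRD // pnatr_eq0 implybT. Qed.

Lemma natrX_le_powR2 (R : realType) (a k : nat) (x : R) :
  a%:R <= 2 `^ x -> (a ^ k)%:R <= 2 `^ (x * k%:R).
Proof.
by move=> le_ax; rewrite powRrM powR_mulrn ?powR_ge0 // natrX lerXn2r // nnegrE ?powR_ge0.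
Qed.

Lemma up_log2_le (R : realType) (p : nat) (x : R) :
  0 <= x -> p%:R <= 2 `^ x -> (up_log 2 p)%:R <= x + 1.
Proof.
move=> x_ge0 le_px; have [p_le1|p_gt1] := leqP p 1.
  have /eqP-> : up_log 2 p == 0%N by rewrite up_log_eq0 p_le1.
  by rewrite addr_ge0.
have := up_log_gtn (isT : (1 < 2)%N) p_gt1.
have /prednK <- : (0 < up_log 2 p)%N by rewrite up_log_gt0 p_gt1.
rewrite /= -natr1 lerD2r -(ltr_nat R) => /lt_le_trans/(_ le_px)/ltW.
by rewrite natrX -powR_mulrn // ler_powR2.
Qed.

(** * The bound in terms of m *)

Theorem theorem1p5 (R : realType) (m p l : nat) (H : sgraph)
    (hm : (27 <= m)%N) (hp0 : (0 < p)%N) (hl0 : (0 < l)%N)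
    (hp : p%:R <= 27 * Num.sqrt (m%:R : R)
                  + 16 * Num.sqrt m%:R / log2 m%:R ^+ 3)
    (hl : l%:R <= 27 * Num.sqrt (m%:R : R))
    (hDelta : (max_degree H)%:R
                <= 16 * Num.sqrt (m%:R : R) / log2 m%:R ^+ 3)
    (hn : (#|H|)%:R <= 2 `^ (106 * Num.sqrt (m%:R : R) / log2 m%:R))
    (hS : exists S : {set H},
        (#|S|)%:R <= Num.sqrt ((m%:R : R) ^+ 3) - 27 * Num.sqrt m%:R
        /\ (max_degree (delete S))%:R < log2 (m%:R : R) / 4) :
  (ramsey (complete p) (join (complete l) H))%:R
    <= 2 `^ (250 * Num.sqrt (m%:R : R)).
Proof.
have m_gt0 : 0 < m%:R :> R by rewrite ltr0n; apply: leq_trans hm.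
set s := Num.sqrt (m%:R : R) in hp hl hDelta hn *.
set L := log2 (m%:R : R) in hp hDelta hn.
set D := max_degree H in hDelta.
have s_gt0 : 0 < s by rewrite sqrtr_gt0.
have sE : 2 `^ (L / 2) = s by apply: powR2_half_log2.
have pow2 (k : nat) : (2 ^ k)%:R = 2 `^ k%:R :> R by rewrite powR_mulrn ?natrX.
have L_ge4 : 4 <= L.
  rewrite -ler_powR2 powR2_log2 // -[4]/(4%:R) -pow2 ler_nat.
  by apply: leq_trans hm.
have L_gt0 : 0 < L by lra.
have slack : 16 * s / L ^+ 3 <= s / 4.
  rewrite ler_pdivrMr ?exprn_gt0 //.
  have -> : 16 * s = s / 4 * 4 ^+ 3 by field.
  rewrite ler_wpM2l ?lerXn2r ?nnegrE //; lra.
(* p <= 28 s, rounded up to 32 s. *)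
have le_ps : p%:R <= 2 `^ (5 + L / 2).
  by rewrite powR2D sE -[5]/(5%:R) -pow2 natrX; lra.
set h := up_log 2 p.
(* log p <= 5 + L / 2, rounding up adds 1, and 6 + L / 2 <= 2 L for L >= 4. *)
have h_le : h%:R <= 2 * L.
  by have := up_log2_le _ le_ps; rewrite -/h; lra.
have base_le : (8 * p)%:R <= 2 `^ (5 / 2 * L).
  apply: le_trans (_ : 2 `^ (3 + (5 + L / 2)) <= _); last by rewrite ler_powR2; lra.
  rewrite powR2D natrM ler_pM // -[3]/(3%:R) -pow2.
  by [].
have DL_le : D%:R * L ^+ 2 <= 4 * s.
  have : D%:R * L ^+ 3 <= 16 * s by rewrite -ler_pdivlMr ?exprn_gt0.
  have : 0 <= D%:R * L ^+ 2 by rewrite mulr_ge0 // exprn_ge0 // ltW.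
  by rewrite (exprS L 2); nra.
have n_le : (maxn 1 #|H|)%:R <= 2 `^ (106 * s / L).
  have [_|_] := leqP 1 #|H|; first exact: hn.
  by rewrite -[1%:R](powRr0 (2 : R)) ler_powR2; apply: divr_ge0; lra.
have nL_le : 106 * s / L <= 106 * s / 4.
  by rewrite ler_pM2l ?mulr_gt0 // lef_pV2 ?posrE.
apply: le_trans (_ : (2 ^ (p + l) * bounded_degree_ramsey #|H| D p h)%:R <= _).
  by rewrite ler_nat ramsey_join_le // up_logP.
rewrite /bounded_degree_ramsey !natrM.
apply: le_trans (_ : 2 `^ (p + l)%:R *
    (2 `^ (106 * s / L) * 2 `^ (5 / 2 * L * (D * h)%:R)) <= _).
  rewrite pow2 ler_wpM2l ?powR_ge0 // ler_pM //.
  exact: natrX_le_powR2.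
rewrite -!powR2D ler_powR2 natrD natrM.
(* With h <= 2 L the last exponent is at most 5 D L^2 <= 20 s; the others are at
   most (54 + 1/4) s and 106 s / 4. *)
have : 5 / 2 * L * (D%:R * h%:R) <= 5 * (D%:R * L ^+ 2).
  rewrite expr2 [leLHS](_ : _ = 5 / 2 * (D%:R * L) * h%:R); last by ring.
  have : 0 <= D%:R * L by rewrite mulr_ge0 // ltW.
  nra.
lra.
Qed.
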